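(* Let $G=(V,E)$ be any finite simple graph with $|V|=n\geq 1$ and $|E|=m$. Then for any integer $k\geq 3$, $$s_k(G)\geq \frac{2m}{n(k-2)}+1 .$$
   Context: $P_k$ denotes the path on $k$ vertices. A $P_k$-coloring of a graph $G$ is a proper vertex coloring of $G$ in which no copy of $P_k$ in $G$ (as a subgraph, not necessarily induced) is bicolored, i.e. has its vertices colored using only two colors. The $P_k$-chromatic number $s_k(G)$ is the minimum number of colors in a $P_k$-coloring of $G$. *)

(* Defs.v *)
From mathcomp Require Import all_boot all_order all_algebra.

Set Implicit Arguments.
Unset Strict Implicit.
Unset Printing Implicit Defensive.

Record sgraph := SGraph {
  vertex :> finType;
  adj : rel vertex;
  adj_sym : symmetric adj;
  adj_irrefl : irreflexive adj
}.

Definition edges (G : sgraph) : {set {set G}} :=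
  [set [set x; y] | x in G, y in G & adj x y].

(* A copy of P_k (not necessarily induced) is given by listing its k distinct
   vertices along the path; each copy is listed twice, once per direction. *)
Definition is_path (G : sgraph) (k : nat) (p : k.-tuple G) : bool :=
  uniq p && sorted (@adj G) p.

Definition proper (G : sgraph) (r : nat) (c : {ffun G -> 'I_r}) : bool :=
  [forall x : G, forall y : G, adj x y ==> (c x != c y)].

(* Under a proper coloring, a path on at least 2 vertices has at least two
   colors, so "at most two" and "exactly two" agree. *)
Definition bicolored (G : sgraph) (r : nat) (c : {ffun G -> 'I_r})
    (k : nat) (p : k.-tuple G) : bool :=
  #|[set c x | x in p]| <= 2.

Definition Pk_coloring (G : sgraph) (k r : nat) (c : {ffun G -> 'I_r}) : bool :=
  proper c && [forall p : k.-tuple G, is_path p ==> ~~ bicolored c p].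

Definition Pk_colorable (G : sgraph) (k r : nat) : bool :=
  [exists c : {ffun G -> 'I_r}, Pk_coloring k c].

(* The coloring with pairwise distinct colors. The bound on k is needed: a
   path on at most 2 vertices is always bicolored. *)
Lemma Pk_colorable_ex (G : sgraph) (k : nat) (hk : 3 <= k) :
  exists r, Pk_colorable G k r.
Proof.
exists #|G|; apply/existsP; exists [ffun x => enum_rank x].
apply/andP; split.
  apply/forallP=> x; apply/forallP=> y; apply/implyP=> xy.
  rewrite !ffunE; apply/eqP=> /enum_rank_inj exy.
  by rewrite exy adj_irrefl in xy.
apply/forallP=> p; apply/implyP=> /andP[up _].
rewrite /bicolored card_imset => [|x y].
  by rewrite (card_uniqP up) size_tuple -ltnNge.
by rewrite !ffunE => /enum_rank_inj.
Qed.

Definition Pk_chromatic (G : sgraph) (k : nat) (hk : 3 <= k) : nat :=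
  ex_minn (Pk_colorable_ex G hk).

(* Main.v *)
Require Import Defs.
From mathcomp Require Import all_boot all_order all_algebra.
From mathcomp Require Import zify.
Import Order.TTheory GRing.Theory Num.Theory.

Set Implicit Arguments.
Unset Strict Implicit.
Unset Printing Implicit Defensive.

(** Two color classes of a P_k-coloring with r colors span a subgraph without
    P_k, which by the Erdős-Gallai theorem has at most (k-2)/2 times as many
    edges as vertices. Each edge lies in exactly one such subgraph and each vertex in
    r-1 of them, so summing over the pairs of colors gives 2m <= (k-2)(r-1)n.

    For Erdős-Gallai, delete a vertex of degree at most (k-2)/2 if there is
    one. Otherwise, by a crossing argument at its two ends, the vertices of a
    longest path carry a cycle. An edge leaving the cycle would give a longer
    path, so these at most k-1 vertices form a union of components, in which
    all degrees are at most k-2, and they can be deleted. *)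

(** * Longest paths, cycles and the Erdős-Gallai bound *)

Section ErdosGallai.

Variables (T : finType) (e : rel T).
Hypotheses (e_sym : symmetric e) (e_irr : irreflexive e).

Definition nbrs (S : {set T}) (x : T) : {set T} := [set y in S | e x y].

Lemma card_nbrs (S : {set T}) (x : T) : #|nbrs S x| = \sum_(y in S) e x y.
Proof.
rewrite -sum1_card big_mkcond [RHS]big_mkcond /=; apply: eq_bigr => y _.
by rewrite inE; case: (y \in S); case: (e x y).
Qed.

Definition path_in (S : {set T}) (p : seq T) : bool :=
  [&& uniq p, sorted e p & all [in S] p].

Lemma longest_path_in (S : {set T}) (v : T) : v \in S ->
  exists x p, path_in S (x :: p) /\
    (forall q, path_in S q -> size q <= (size p).+1).
Proof.
move=> vS; pose P n := [exists t : n.-tuple T, path_in S t].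
have exP : exists n, P n.
  by exists 1; apply/existsP; exists [tuple v]; rewrite /path_in /= vS.
have PP q : path_in S q -> P (size q).
  by move=> hq; apply/existsP; exists (in_tuple q).
have ubP n : P n -> n <= #|T|.
  case/existsP=> t /and3P[ut _ _].
  by rewrite -(size_tuple t) -(card_uniqP ut) max_card.
case: (ex_maxnP exP ubP) => n /existsP[[[|x p] /= /eqP <-] hp] maxn.
  have : P 1 by apply: (PP [:: v]); rewrite /path_in /= vS.
  by move/maxn.
by exists x, p; split=> // q /PP /maxn.
Qed.

(** Pigeonhole on the [size p] steps of the path: those whose head is a neighbor of [x] and those
    whose tail is a neighbor of the last vertex are too many to be disjoint. *)
Lemma crossing (S : {set T}) (x : T) (p : seq T) :
  nbrs S x \subset x :: p -> nbrs S (last x p) \subset x :: p ->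
  size p < #|nbrs S x| + #|nbrs S (last x p)| ->
  exists2 i, i < size p &
    e x (nth x p i) && e (nth x (x :: p) i) (last x p).
Proof.
move=> /subsetP Nx /subsetP Ny lt_p.
pose I := [set i : 'I_(size p) | e x (nth x p i)].
pose J := [set i : 'I_(size p) | e (nth x (x :: p) i) (last x p)].
have leI : #|nbrs S x| <= #|I|.
  apply: leq_trans (leq_imset_card (fun i : 'I_(size p) => nth x p i) I).
  apply/subset_leq_card/subsetP=> z zN; move: (zN) (Nx z zN).
  rewrite !inE => /andP[_ xz] /orP[/eqP zx|zp]; first by rewrite zx e_irr in xz.
  rewrite -index_mem in zp; apply/imsetP; exists (Ordinal zp).
    by rewrite inE /= nth_index -?index_mem.
  by rewrite /= nth_index -?index_mem.
have leJ : #|nbrs S (last x p)| <= #|J|.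
  apply: leq_trans
    (leq_imset_card (fun i : 'I_(size p) => nth x (x :: p) i) J).
  apply/subset_leq_card/subsetP=> z zN; move: (zN) (Ny z zN).
  rewrite inE => /andP[_ yz] zp.
  (* A neighbor of the last vertex is not that vertex itself, so a step of the path starts at it. *)
  have zlt : index z (x :: p) < size p.
    have : index z (x :: p) < (size p).+1
      by rewrite -[X in _ < X]/(size (x :: p)) index_mem.
    rewrite ltnS leq_eqVlt => /orP[/eqP iz|//].
    have := nth_index x zp.
    rewrite iz -[size p]/((size (x :: p)).-1) nth_last /=.
    by move=> ez; rewrite ez e_irr in yz.
  apply/imsetP; exists (Ordinal zlt); last first.
    by rewrite [LHS](esym (nth_index x zp)).
  by rewrite inE [nth _ _ _](nth_index x zp) e_sym.
have : I :&: J != set0.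
  have := cardsUI I J; have := subset_leq_card (subsetT (I :|: J)).
  by rewrite cardsT card_ord -card_gt0; lia.
case/set0Pn=> i; rewrite !inE => /andP[xi iy].
by exists (val i); [exact: ltn_ord | rewrite xi iy].
Qed.

Lemma crossing_cycle (x y : T) (s t : seq T) :
  path e x (s ++ y :: t) -> e x y -> e (last x s) (last y t) ->
  cycle e (x :: s ++ rev (y :: t)).
Proof.
rewrite cat_path /= => /and3P[xs _ yt] xy st.
(* The closing edge from [y] to [x] is absorbed into the reversed stretch, which becomes the
   reversal of [x :: y :: t]. *)
rewrite rcons_cat cat_path xs -rev_cons lastI rev_rcons.
rewrite /= st -[last y t]/(last x (y :: t)) rev_path.
by rewrite (eq_path (e' := e)) /= ?xy.
Qed.

(** Were [w] off the cycle, cutting the cycle open at [z] and putting [w] in front would give a path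
    with one more vertex than [c]. *)
Lemma cycle_maximal (S : {set T}) (c : seq T) :
  uniq c -> cycle e c -> {subset c <= S} ->
  (forall q, path_in S q -> size q <= size c) ->
  {in c & S, forall z w, e z w -> w \in c}.
Proof.
move=> uc cc cS maxc z w zc wS zw; apply: contraT => wc.
case: (rot_to zc) => i c' rc.
have : path_in S (w :: z :: c').
  rewrite /path_in -[z :: c']rc cons_uniq mem_rot wc rot_uniq uc /=.
  rewrite wS; apply/andP; split.
    rewrite rc /= e_sym zw /=; move: cc; rewrite -(rot_cycle i) rc /=.
    by rewrite rcons_path => /andP[].
  by apply/allP=> u; rewrite mem_rot => /cS.
move/maxc; rewrite -(size_rot i c) rc /=; lia.
Qed.

Lemma spanning_cycle_of_longest (S : {set T}) (x : T) (p : seq T) :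
  path_in S (x :: p) ->
  (forall q, path_in S q -> size q <= (size p).+1) ->
  {in S, forall v, size p < 2 * #|nbrs S v|} ->
  exists2 c, cycle e c & perm_eq c (x :: p).
Proof.
move=> /and3P[up xp pS] maxp deg.
have xS : x \in S by case/andP: pS.
have yS : last x p \in S by apply: (allP pS); exact: mem_last.
have Nx : nbrs S x \subset x :: p.
  apply/subsetP=> z; rewrite inE => /andP[zS xz]; apply: contraT => zp.
  have : path_in S (z :: x :: p).
    apply/and3P; split; first by rewrite cons_uniq zp.
      by rewrite /= e_sym xz.
    by rewrite /= zS.
  by move/maxp; rewrite /= ltnn.
have Ny : nbrs S (last x p) \subset x :: p.
  apply/subsetP=> z; rewrite inE => /andP[zS yz]; apply: contraT => zp.
  have : path_in S (rcons (x :: p) z).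
    apply/and3P; split; first by rewrite rcons_uniq zp.
      by rewrite /= rcons_path yz andbT.
    by rewrite all_rcons zS.
  by move/maxp; rewrite size_rcons /= ltnn.
have [|i lip /andP[xi iy]] := crossing Nx Ny.
  by have := deg _ xS; have := deg _ yS; lia.
(* The predecessor of entry [i] of [p] on the path; for [i = 0] it is [x]. *)
have lasti : last x (take i p) = nth x (x :: p) i.
  case: i lip {xi iy} => [|i] lip; first by rewrite take0.
  by rewrite -nth_last size_take lip nth_take.
exists (x :: take i p ++ rev (drop i p)); last first.
  by rewrite perm_cons -{3}(cat_take_drop i p) perm_cat2l perm_rev.
move: xp iy; rewrite /= -{1 3}(cat_take_drop i p) (drop_nth x lip) last_cat.
by rewrite -lasti; move=> *; apply: crossing_cycle.
Qed.

(** The degree sum is twice the number of edges inside [S], and [d] stands for [k - 2]. Working with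
    subsets of a fixed [T] lets the induction on [#|S|] delete vertices. *)
Theorem erdos_gallai (d : nat) (S : {set T}) :
  (forall p, path_in S p -> size p <= d.+1) ->
  \sum_(x in S) #|nbrs S x| <= d * #|S|.
Proof.
have [n] := ubnP #|S|; elim: n S => // n IHn S ltSn hS.
have IH (A : {set T}) : A \subset S -> A != set0 ->
    \sum_(x in S :\: A) #|nbrs (S :\: A) x| <= d * #|S :\: A|.
  move=> AS A0; apply: IHn => [|p /and3P[up sp pA]].
    have := cardsD S A; rewrite (setIidPr AS); rewrite -card_gt0 in A0.
    have := subset_leq_card AS; lia.
  apply: hS; rewrite /path_in up sp; apply: sub_all pA => z.
  by rewrite inE => /andP[].
have [v /andP[vS lev]|nov] :=
    pickP (fun v => (v \in S) && (2 * #|nbrs S v| <= d)).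
  have := IH [set v]; rewrite sub1set vS -card_gt0 cards1 => /(_ isT isT) IHv.
  (* Deleting [v] costs its degree twice, as its own term and through its neighbors: at most [d] in
     total. *)
  have split_deg z : #|nbrs S z| = e z v + #|nbrs (S :\ v) z|.
    rewrite (cardsD1 v) inE vS; congr (_ + #|pred_of_set _|).
    by apply/setP=> y; rewrite !inE andbA.
  have degv : \sum_(z in S :\ v) e z v = #|nbrs S v|.
    by rewrite split_deg e_irr card_nbrs; apply: eq_bigr => z _; rewrite e_sym.
  rewrite (big_setD1 v) //= (eq_bigr _ (fun z _ => split_deg z)) big_split /=.
  rewrite degv (cardsD1 v S) vS; nia.
have [->|[v vS]] := set_0Vmem S; first by rewrite big_set0.
have [x [p [hp maxp]]] := longest_path_in vS.
have lepd : size p <= d by have := hS _ hp.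
have [u uS|c cc cp] := spanning_cycle_of_longest hp maxp.
  by have := nov u; rewrite /= uS /= => /negbT; rewrite -ltnNge; lia.
have /and3P[up _ /allP pS] := hp.
have uc : uniq c by rewrite (perm_uniq cp).
have sc : size c = (size p).+1 by rewrite (perm_size cp).
have cS : {subset c <= S} by move=> z; rewrite (perm_mem cp); apply: pS.
have closed_c : {in c & S, forall z w, e z w -> w \in c}.
  by apply: cycle_maximal => // q; rewrite sc; apply: maxp.
pose A := [set z in c].
have AS : A \subset S by apply/subsetP=> z; rewrite inE; apply: cS.
have cardA : #|A| = (size p).+1 by rewrite cardsE (card_uniqP uc).
have A0 : A != set0 by rewrite -card_gt0 cardA.
have degA z : z \in A -> #|nbrs S z| <= d.
  move=> zA; have : nbrs S z \subset A :\ z.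
    apply/subsetP=> w; rewrite !inE => /andP[wS zw].
    rewrite (closed_c z) //; last by rewrite inE in zA.
    by rewrite andbT; apply: contraTneq zw => ->; rewrite e_irr.
  by move/subset_leq_card; have := cardsD1 z A; rewrite zA cardA; lia.
(* By symmetry no edge enters [A] from the rest of [S], so deleting [A] changes no other degree. *)
have degD z : z \in S :\: A -> nbrs S z = nbrs (S :\: A) z.
  rewrite inE => /andP[zA zS]; apply/setP=> w; rewrite !inE.
  case wS: (w \in S); rewrite ?andbF //= andbT.
  case zw: (e z w); rewrite ?andbF //= andbT; apply/esym.
  apply: contra zA => wc; rewrite inE.
  by apply: (closed_c w) => //; rewrite e_sym.
rewrite (big_setID A) /= (setIidPr AS) -(cardsID A S) (setIidPr AS) mulnDr.
apply: leq_add; first by rewrite mulnC -sum_nat_const leq_sum.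
by rewrite (eq_bigr (fun z => #|nbrs (S :\: A) z|)) ?IH // => z /degD->.
Qed.

End ErdosGallai.

(** * Summing over pairs of color classes *)

Lemma edges_double_leq (G : sgraph) :
  2 * #|edges G| <= \sum_(x : G) \sum_(y : G) adj x y.
Proof.
pose A := [set u : G * G | adj u.1 u.2].
have -> : \sum_(x : G) \sum_(y : G) adj x y = #|A|.
  rewrite pair_bigA /= -sum1_card [RHS]big_mkcond /=.
  by apply: eq_bigr => u _; rewrite inE; case: adj.
pose f (u : G * G) := [set u.1; u.2].
have -> : edges G = f @: A.
  apply/setP=> E; apply/imset2P/imsetP => [[x y _ + ->]|[[x y]]].
    by rewrite inE => xy; exists (x, y); rewrite ?inE.
  by rewrite inE => xy ->; exists x y; rewrite ?inE.
(* Each edge has at least two preimages under [f], its two orientations, distinct by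
   irreflexivity. *)
rewrite -[leqRHS]sum1_card (partition_big_imset f) /= mulnC -sum_nat_const.
apply: leq_sum => E /imsetP[[x y]]; rewrite inE => /= xy ->.
rewrite sum1_card; have xny : (x, y) != (y, x).
  by apply: contraTneq xy => -[-> _]; rewrite adj_irrefl.
rewrite -[2](_ : #|[set (x, y); (y, x)]| = 2); last by rewrite cards2 xny.
apply/subset_leq_card/subsetP=> u; rewrite !inE unfold_in /=.
by case/orP=> /eqP->; rewrite inE /= ?xy 1?adj_sym ?xy ?eqxx // /f /= setUC.
Qed.

(** The first [d.+2] vertices of a longer path would form a bicolored copy of the forbidden path. *)
Lemma Pk_coloring_path_size (G : sgraph) (d r : nat) (c : {ffun G -> 'I_r})
    (i j : 'I_r) (p : seq G) :
  Pk_coloring d.+2 c -> path_in (@adj G) (c @^-1: [set i; j]) p ->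
  size p <= d.+1.
Proof.
case/andP=> _ /forallP nobic /and3P[up sp /allP pS].
rewrite leqNgt; apply/negP=> ltdp.
have sz : size (take d.+2 p) == d.+2 by rewrite size_takel.
have := nobic (Tuple sz); rewrite /is_path /= take_uniq // take_sorted //=.
apply/negP; rewrite negbK; apply: leq_trans (_ : #|[set i; j]| <= 2).
  apply/subset_leq_card/subsetP=> a /imsetP[x xp ->].
  by have := pS _ (mem_take xp); rewrite inE.
by rewrite cards2; case: (_ != _).
Qed.

Lemma Pk_coloring_edges (G : sgraph) (d r : nat) (c : {ffun G -> 'I_r}) :
  Pk_coloring d.+2 c -> 2 * #|edges G| <= d * (r.-1 * #|G|).
Proof.
move=> hc; have /andP[/forallP hproper _] := hc.
apply: leq_trans (edges_double_leq G) _.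
pose C i := c @^-1: [set i].
pose D i j := \sum_(x in C i) \sum_(y in C j) adj x y.
(* Properness removes the terms with [j = i]. *)
have DE : \sum_(x : G) \sum_(y : G) adj x y
    = \sum_(i : 'I_r) \sum_(j | j != i) D i j.
  rewrite (partition_big c xpredT) //=; apply: eq_bigr => i _.
  rewrite [RHS]exchange_big /=; apply: eq_big => x; first by rewrite !inE.
  move=> /eqP cx; rewrite (partition_big c xpredT) //= (bigD1 i) //=.
  rewrite big1 ?add0n => [|y /eqP cy].
    by apply: eq_bigr => j _; apply: eq_bigl => y; rewrite !inE.
  by have /forallP/(_ y) := hproper x; rewrite cx cy eqxx implybF => /negPf->.
have leD i j : j != i -> D i j + D j i <= d * (#|C i| + #|C j|).
  move=> ij; have := erdos_gallai (@adj_sym G) (@adj_irrefl G) (d := d)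
    (S := c @^-1: [set i; j]) (fun p => Pk_coloring_path_size hc).
  have CU : c @^-1: [set i; j] = C i :|: C j.
    by apply/setP=> x; rewrite !inE.
  have Cdis : [disjoint C i & C j].
    rewrite disjoint_subset; apply/subsetP=> x; rewrite !inE => /eqP->.
    by rewrite eq_sym.
  rewrite CU cardsU disjoint_setI0 // cards0 subn0; apply: leq_trans.
  have deg_leq (B : {set G}) x : B \subset C i :|: C j ->
      \sum_(y in B) adj x y <= #|nbrs (@adj G) (C i :|: C j) x|.
    move=> sB; rewrite -card_nbrs; apply/subset_leq_card/subsetP=> y.
    by rewrite ![y \in nbrs _ _ _]inE => /andP[/(subsetP sB)-> ->].
  rewrite (eq_bigl [predU C i & C j]) ?bigU //=; last by move=> x; rewrite !inE.
  apply: leq_add; apply: leq_sum => x _.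
    by apply: deg_leq; rewrite subsetUr.
  by apply: deg_leq; rewrite subsetUl.
have swap (F : 'I_r -> 'I_r -> nat) :
    \sum_i \sum_(j | j != i) F i j = \sum_i \sum_(j | j != i) F j i.
  rewrite (exchange_big_dep xpredT) //=; apply: eq_bigr => i _.
  by apply: eq_bigl => j; rewrite eq_sym.
have sumC : \sum_i \sum_(j : 'I_r | j != i) #|C i| = r.-1 * #|G|.
  under eq_bigr => i _.
    rewrite sum_nat_const (_ : #|_| = r.-1); last first.
      by have := cardC1 i; rewrite card_ord.
    over.
  rewrite -big_distrr /=; congr (_ * _).
  rewrite -sum1_card (partition_big c xpredT) //=; apply: eq_bigr => i _.
  by rewrite -sum1_card; apply: eq_bigl => x; rewrite !inE.
(* Doubling the sum over ordered pairs of colors matches each [D i j] with [D j i], so that [leD]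
   applies termwise; the class sizes then add up to twice [r.-1 * #|G|]. *)
rewrite DE -(leq_pmul2l (m := 2)) // mul2n -addnn {2}swap -big_split /=.
under eq_bigr => i _ do rewrite -big_split /=.
apply: leq_trans (leq_sum _ (fun i _ => leq_sum _ (fun j => @leD i j))) _.
under eq_bigr => i _ do rewrite -big_distrr big_split /=.
by rewrite -big_distrr big_split /= -[X in _ + X]swap sumC addnn -mul2n mulnCA.
Qed.

Local Open Scope ring_scope.

Theorem theorem2 (G : sgraph) (hn : (1 <= #|G|)%N) (k : nat) (hk : (3 <= k)%N) :
  ((2 * #|edges G|)%N%:R / (#|G|%:R * (k%:R - 2)) + 1 : rat)
    <= (Pk_chromatic G hk)%:R.
Proof.
rewrite /Pk_chromatic; case: ex_minnP => r /existsP[c hc] _.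
(* A vertex has a color, so [r.-1] casts to [r - 1] in the rationals. *)
have r0 : (0 < r)%N.
  by case/card_gt0P: hn => x _; apply: leq_ltn_trans (ltn_ord (c x)).
case: k hk c hc => [|[|d]] // hd c /Pk_coloring_edges le_m.
have -> : (d.+2%:R - 2 : rat) = d%:R by rewrite -addn2 natrD addrK.
rewrite -lerBrDr -(natrB _ r0) subn1 ler_pdivrMr; last first.
  by rewrite mulr_gt0 ?ltr0n.
by rewrite -!natrM ler_nat mulnA [leqRHS]mulnC.
Qed.
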